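(* Let $A$ be an $\ell$-open $C^*$-algebra. Then $A$ is $\ell$-closed.
   Context: Ideals of $C^*$-algebras are closed and two-sided; for an ideal $I$ of a $C^*$-algebra $B$, $\pi_I:B\to B/I$ is the quotient map. $\mathrm{Hom}(A,B)$ is the space of all $^*$-homomorphisms $A\to B$ (not necessarily unital) with the point-norm topology (pointwise norm convergence on $A$). Let $\mathrm{Hom}(A,B,I)=\{\pi_I\circ\phi:\phi\in\mathrm{Hom}(A,B)\}\subseteq\mathrm{Hom}(A,B/I)$ be the set of liftable $^*$-homomorphisms. $A$ is $\ell$-open (respectively $\ell$-closed) if for every $C^*$-algebra $B$ and every ideal $I$ of $B$, the set $\mathrm{Hom}(A,B,I)$ is open (respectively closed) in $\mathrm{Hom}(A,B/I)$. *)

(* Defs.v *)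
From HB Require Import structures.
From mathcomp Require Import all_boot all_order all_algebra generic_quotient.
From mathcomp Require Import ring_quotient complex.
From mathcomp Require Import all_classical all_reals all_analysis.

Set Implicit Arguments.
Unset Strict Implicit.
Unset Printing Implicit Defensive.

Import Order.TTheory GRing.Theory Num.Theory.
Import numFieldNormedType.Exports.

Local Open Scope classical_set_scope.
Local Open Scope complex_scope.
Local Open Scope quotient_scope.
Local Open Scope ring_scope.

(* The complex numbers are R[i] for a realType R, and norms of complex normed
   spaces take (nonnegative real) values in R[i], as the library requires. *)

(* Operations only, no axioms: this is all that is needed of the codomain in
   order to say what a *-homomorphism is. *)
HB.mixin Record hasMulStar (R : realType) (V : Type)
    & NormedModule R[i] V := {
  cmul : V -> V -> V;
  cstar : V -> V
}.

#[short(type="mulStarType")]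
HB.structure Definition MulStar (R : realType) :=
  {V of NormedModule R[i] V & hasMulStar R V}.

(* The multiplication is not required to have a unit, hence the ring
   structures of the library do not apply. *)
HB.mixin Record isCStarAlgebra (R : realType) (V : Type)
    & MulStar R V & Complete V := {
  cmulA : associative (@cmul R V);
  cmulDl : left_distributive (@cmul R V) +%R;
  cmulDr : right_distributive (@cmul R V) +%R;
  cmulZl : forall (a : R[i]) (x y : V), cmul (a *: x) y = a *: cmul x y;
  cmulZr : forall (a : R[i]) (x y : V), cmul x (a *: y) = a *: cmul x y;
  cmul_le_norm : forall x y : V, `|cmul x y| <= `|x| * `|y|;
  cstarK : involutive (@cstar R V);
  cstarD : {morph @cstar R V : x y / x + y};
  cstarZ : forall (a : R[i]) (x : V), cstar (a *: x) = a^* *: cstar x;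
  cstarM : forall x y : V, cstar (cmul x y) = cmul (cstar y) (cstar x);
  cstar_norm : forall x : V, `|cmul (cstar x) x| = `|x| ^+ 2
}.

#[short(type="cstarAlgType")]
HB.structure Definition CStarAlgebra (R : realType) :=
  {V of CompleteNormedModule R[i] V & MulStar R V & isCStarAlgebra R V}.

(* Membership is boolean, as the library's quotients require. *)
Record cstarIdeal (R : realType) (B : cstarAlgType R) := CStarIdeal {
  ideal_mem :> {pred B};
  ideal_submod : submod_closed ideal_mem;
  ideal_mulr : forall x y : B, x \in ideal_mem -> cmul x y \in ideal_mem;
  ideal_mull : forall x y : B, y \in ideal_mem -> cmul x y \in ideal_mem;
  ideal_closed : closed [set x : B | x \in ideal_mem]
}.

HB.instance Definition _ (R : realType) (B : cstarAlgType R)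
    (I : cstarIdeal B) :=
  GRing.isSubmodClosed.Build R[i] B (ideal_mem I) (ideal_submod I).

Section Quotient.
Variables (R : realType) (B : cstarAlgType R) (I : cstarIdeal B).

Definition cquot : Type := {ideal_quot (ideal_mem I)}.

HB.instance Definition _ := GRing.Zmodule.on cquot.

Definition cquot_pi (b : B) : cquot := \pi_{ideal_quot (ideal_mem I)} b.
Definition cquot_repr (x : cquot) : B := repr (x : {ideal_quot (ideal_mem I)}).

Lemma cquot_reprK : cancel cquot_repr cquot_pi.
Proof. exact: reprK. Qed.

Lemma cquot_piE x y : cquot_pi x = cquot_pi y <-> x - y \in I.
Proof.
rewrite /cquot_pi; split=> [/eqP|xy]; first by rewrite -Quotient.idealrBE.
by apply/eqP; rewrite -Quotient.idealrBE.
Qed.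

Lemma cquot_piD : {morph cquot_pi : x y / x + y}.
Proof. by move=> x y; rewrite /cquot_pi !piE. Qed.

Lemma cquot_pi0 : cquot_pi 0 = 0.
Proof. by rewrite /cquot_pi !piE. Qed.

Lemma cquot_pi_eq0 x : cquot_pi x = 0 <-> x \in I.
Proof. by rewrite -cquot_pi0 cquot_piE subr0. Qed.

Definition cquot_scale (a : R[i]) (x : cquot) : cquot :=
  cquot_pi (a *: cquot_repr x).

Lemma cquot_pi_scale a x : cquot_scale a (cquot_pi x) = cquot_pi (a *: x).
Proof.
apply/cquot_piE; rewrite -scalerBr rpredZ//.
by apply/cquot_piE; rewrite cquot_reprK.
Qed.

Fact cquot_scaleA a b x :
  cquot_scale a (cquot_scale b x) = cquot_scale (a * b) x.
Proof. by rewrite -[x]cquot_reprK !cquot_pi_scale scalerA. Qed.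

Fact cquot_scale1 : left_id 1 cquot_scale.
Proof. by move=> x; rewrite -[x]cquot_reprK cquot_pi_scale scale1r. Qed.

Fact cquot_scaleDr : right_distributive cquot_scale +%R.
Proof.
move=> a x y; rewrite -[x]cquot_reprK -[y]cquot_reprK.
by rewrite -cquot_piD !cquot_pi_scale scalerDr; exact: cquot_piD.
Qed.

Fact cquot_scaleDl x : {morph cquot_scale^~ x : a b / a + b}.
Proof.
by move=> a b; rewrite -[x]cquot_reprK !cquot_pi_scale scalerDl; exact: cquot_piD.
Qed.

HB.instance Definition _ := GRing.Zmodule_isLmodule.Build R[i] cquot
  cquot_scaleA cquot_scale1 cquot_scaleDr cquot_scaleDl.

Lemma cquot_piZ a x : cquot_pi (a *: x) = a *: cquot_pi x.
Proof. by rewrite -cquot_pi_scale. Qed.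

(* The quotient norm; [Re] only turns the norm of B into an element of R,
   where infima are available. *)
Definition cquot_rnorm (x : cquot) : R :=
  inf [set complex.Re `|b| | b in [set b : B | cquot_pi b = x]].

Definition cquot_norm (x : cquot) : R[i] := (cquot_rnorm x)%:C.

Let ReE (b : B) : (complex.Re `|b|)%:C = `|b|.
Proof. exact/RRe_real/normr_real. Qed.

Let Re_ge0 (b : B) : 0 <= complex.Re `|b|.
Proof. by rewrite -ler0c ReE. Qed.

Let rnorm_set x := [set complex.Re `|b| | b in [set b : B | cquot_pi b = x]].

Let rnorm_has_inf x : has_inf (rnorm_set x).
Proof.
split; first by exists (complex.Re `|cquot_repr x|), (cquot_repr x) => //=;
  exact: cquot_reprK.
by exists 0 => _ [b _ <-].
Qed.

Let rnorm_ge0 x : 0 <= cquot_rnorm x.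
Proof. by apply: lb_le_inf (rnorm_has_inf x).1 _ => _ [b _ <-]. Qed.

Let rnorm_le b : cquot_rnorm (cquot_pi b) <= complex.Re `|b|.
Proof. by apply: ge_inf; [exact: (rnorm_has_inf _).2 | exists b]. Qed.

Let rnorm_adherent x (e : R) : 0 < e ->
  exists2 b, cquot_pi b = x & complex.Re `|b| < cquot_rnorm x + e.
Proof.
by move=> /(inf_adherent)/(_ (rnorm_has_inf x)) [_ [b bx <-] be]; exists b.
Qed.

Fact cquot_ler_normD x y : cquot_norm (x + y) <= cquot_norm x + cquot_norm y.
Proof.
rewrite /cquot_norm -rmorphD/= lecR; apply/ler_addgt0Pr => e e0.
have e20 : 0 < e / 2 by rewrite divr_gt0.
have [b bx be] := rnorm_adherent x e20.
have [c cy ce] := rnorm_adherent y e20.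
rewrite -bx -cy -cquot_piD; apply: le_trans (rnorm_le _) _.
have : complex.Re `|b + c| <= complex.Re `|b| + complex.Re `|c|.
  by rewrite -lecR rmorphD/= !ReE ler_normD.
move/le_trans; apply; rewrite bx cy [e]splitr addrACA.
by rewrite lerD// ltW.
Qed.

Let Re_normZ a (b : B) : complex.Re `|a *: b| = complex.Re `|a| * complex.Re `|b|.
Proof.
by apply: (@complexI R); rewrite rmorphM/= !ReE normrZ.
Qed.

Let rnormZ_le a x : cquot_rnorm (a *: x) <= complex.Re `|a| * cquot_rnorm x.
Proof.
have a0 : 0 <= complex.Re `|a| by rewrite -ler0c RRe_real ?normr_real.
apply/ler_addgt0Pr => e e0.
have d0 : 0 < complex.Re `|a| + 1 by rewrite ltr_wpDl.
have [b bx be] := rnorm_adherent x (divr_gt0 e0 d0).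
rewrite -{1}bx -cquot_piZ; apply: le_trans (rnorm_le _) _; rewrite Re_normZ.
apply: le_trans (ler_wpM2l a0 (ltW be)) _; rewrite mulrDr lerD2l.
by rewrite mulrCA ger_pMr// ler_pdivrMr// mul1r lerDl.
Qed.

Fact cquot_normZ a x : cquot_norm (a *: x) = `|a| * cquot_norm x.
Proof.
have rE (c : R[i]) : (complex.Re `|c|)%:C = `|c| by rewrite RRe_real ?normr_real.
rewrite -(rE a) /cquot_norm -(rmorphM (real_complex R)); congr (_%:C).
apply/eqP; rewrite eq_le rnormZ_le.
have [->|a0] := eqVneq a 0.
  have -> : complex.Re `|0 : R[i]| = 0 by apply: complexI; rewrite rE normr0.
  by rewrite mul0r rnorm_ge0.
have a_gt0 : 0 < complex.Re `|a| by rewrite -ltcR rE normr_gt0.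
have := rnormZ_le a^-1 (a *: x); rewrite scalerA mulVf// scale1r.
have -> : complex.Re `|a^-1| = (complex.Re `|a|)^-1.
  by apply: (@complexI R); rewrite rE fmorphV/= rE normfV.
by rewrite ler_pdivlMl.
Qed.

Fact cquot_norm0_eq0 x : cquot_norm x = 0 -> x = 0.
Proof.
move=> /complexI x0; rewrite -[x]cquot_reprK; apply/cquot_pi_eq0.
set b := cquot_repr x.
apply: (@ideal_closed R B I) => U /nbhs_ballP[e /= e0 beU].
have eE : (complex.Re e)%:C = e by rewrite RRe_real// gtr0_real.
have Re0 : 0 < complex.Re e by rewrite -ltcR eE.
have [c cx ce] := rnorm_adherent x Re0.
exists (b - c); split => /=; first by apply/cquot_piE; rewrite cquot_reprK.
apply: beU; rewrite -ball_normE/= opprB addrC subrK.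
by move: ce; rewrite x0 add0r -ltcR eE ReE.
Qed.

HB.instance Definition _ := Lmodule_isNormed.Build R[i] cquot
  cquot_ler_normD cquot_normZ cquot_norm0_eq0.

(* Closed two-sided ideals of C*-algebras are self-adjoint, so neither operation
   depends on the choice of representatives; the involution is defined without
   appealing to that theorem. *)
HB.instance Definition _ := hasMulStar.Build R cquot
  (fun x y => cquot_pi (cmul (cquot_repr x) (cquot_repr y)))
  (fun x => cquot_pi (cstar (cquot_repr x))).

Lemma cquot_piM x y : cquot_pi (cmul x y) = cmul (cquot_pi x) (cquot_pi y).
Proof.
apply/cquot_piE.
set x' := cquot_repr _; set y' := cquot_repr _.
have xI : x - x' \in I by apply/cquot_piE; rewrite cquot_reprK.
have yI : y - y' \in I by apply/cquot_piE; rewrite cquot_reprK.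
have -> : cmul x y - cmul x' y' = cmul (x - x') y + cmul x' (y - y').
  have mulN (u v : B) : cmul (- u) v = - cmul u v.
    by rewrite -scaleN1r cmulZl scaleN1r.
  have mulrN' (u v : B) : cmul u (- v) = - cmul u v.
    by rewrite -scaleN1r cmulZr scaleN1r.
  by rewrite cmulDl cmulDr mulN mulrN' addrA subrK.
by rewrite rpredD//; [exact: ideal_mulr | exact: ideal_mull].
Qed.

End Quotient.

Section Hom.
Variables (R : realType) (A : cstarAlgType R).

Record star_hom (D : mulStarType R) (f : A -> D) : Prop := StarHom {
  star_homD : {morph f : x y / x + y};
  star_homZ : forall (a : R[i]) (x : A), f (a *: x) = a *: f x;
  star_homM : {morph f : x y / cmul x y};
  star_hom_star : {morph f : x / cstar x}
}.

(* The subspace topology inherited from the pointwise topology, the codomain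
   carrying its norm topology. *)
Definition Hom (D : mulStarType R) : topologicalType :=
  [set f : {ptws A -> D} | star_hom f].

(* The composite of a quotient map and a *-homomorphism is automatically a
   *-homomorphism, so this is the set of all such composites. *)
Definition liftable (B : cstarAlgType R) (I : cstarIdeal B) :
    set (Hom (cquot I)) :=
  [set psi | exists phi : Hom B, \val psi = @cquot_pi R B I \o \val phi].

Arguments liftable : clear implicits.

Definition ell_open : Prop := forall (B : cstarAlgType R) (I : cstarIdeal B),
  open (liftable B I).

Definition ell_closed : Prop := forall (B : cstarAlgType R) (I : cstarIdeal B),
  closed (liftable B I).

End Hom.

Arguments liftable {R} A B I.

(* Main.v *)
From HB Require Import structures.
From mathcomp Require Import all_boot all_order all_algebra complex lra ring.
Require Import Defs.
From mathcomp Require Import all_classical all_reals all_analysis.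

(* Let X be the set of all *-homomorphisms A -> B and let phi be a limit of
   homomorphisms that lift modulo I.  The family of all elements of X is a
   *-homomorphism from A to the bounded families l^oo(X, B), and its image modulo
   l^oo(X, I) is liftable.  Replacing by phi the coordinates psi for which
   pi_I o psi lies in a small neighbourhood of phi gives a homomorphism close to
   that image, hence liftable since A is l-open.  The neighbourhood does contain
   some pi_I o psi, and the coordinate psi of the lift is then a lift of phi.

   This needs *-homomorphisms to be uniformly bounded and closed ideals to be
   self-adjoint.  Both are obtained without spectral theory: a self-adjoint h of
   norm less than 1 is the cosine of an angle whose sine is a formal 1 - z, with
   z a fixed point of a contraction; cosines and sines act contractively by the
   C*-identity. *)

Set Implicit Arguments.
Unset Strict Implicit.
Unset Printing Implicit Defensive.

Import Order.TTheory GRing.Theory Num.Theory.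
Import numFieldNormedType.Exports.

Local Open Scope classical_set_scope.
Local Open Scope complex_scope.
Local Open Scope ring_scope.
Local Notation Hom := Defs.Hom.

(** * Norms with values in the real numbers *)

Section RealNorm.
Variables (R : realType) (V : normedModType R[i]).
Implicit Types x y : V.

Definition rnorm x : R := complex.Re `|x|.

Lemma rnormE x : (rnorm x)%:C = `|x|.
Proof. exact/RRe_real/normr_real. Qed.

Lemma rnorm_ge0 x : 0 <= rnorm x.
Proof. by rewrite -ler0c rnormE. Qed.

Lemma rnorm_eq0 x : rnorm x = 0 -> x = 0.
Proof. by move=> x0; apply/normr0_eq0; rewrite -rnormE x0. Qed.

Lemma rnorm0 : rnorm (0 : V) = 0.
Proof. by apply: (@complexI R); rewrite rnormE normr0. Qed.

Lemma rnormN x : rnorm (- x) = rnorm x.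
Proof. by rewrite /rnorm normrN. Qed.

Lemma rnormB x y : rnorm (x - y) = rnorm (y - x).
Proof. by rewrite -rnormN opprB. Qed.

Lemma ler_rnormD x y : rnorm (x + y) <= rnorm x + rnorm y.
Proof. by rewrite -lecR rmorphD/= !rnormE ler_normD. Qed.

Lemma ler_rnormB x y : rnorm (x - y) <= rnorm x + rnorm y.
Proof. by rewrite -[rnorm y]rnormN ler_rnormD. Qed.

Lemma rnormZ (a : R[i]) x : rnorm (a *: x) = complex.Re `|a| * rnorm x.
Proof.
apply: (@complexI R); rewrite rmorphM/= !rnormE normrZ; congr (_ * _).
Qed.

Lemma rnormZr (r : R) x : 0 <= r -> rnorm (r%:C *: x) = r * rnorm x.
Proof. by move=> r0; rewrite rnormZ ger0_norm// ler0c. Qed.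

Lemma rnormMn x n : rnorm (x *+ n) = rnorm x *+ n.
Proof. by apply: (@complexI R); rewrite rmorphMn/= !rnormE normrMn. Qed.

(** Used to pass equations to a limit: approximation to within [e] leaves an error proportional to
    [e]. *)
Lemma rnorm_small_eq0 (C : R) x : 0 <= C ->
  (forall e, 0 < e -> rnorm x <= C * e) -> x = 0.
Proof.
move=> C0 xe; apply/rnorm_eq0/eqP; rewrite eq_le rnorm_ge0 andbT.
have C1 : 0 < C + 1 by rewrite ltr_wpDl.
apply/ler_addgt0Pr => e e0; rewrite add0r.
apply: le_trans (xe _ (divr_gt0 e0 C1)) _.
by rewrite mulrCA ger_pMr// ler_pdivrMr// mul1r lerDl.
Qed.

End RealNorm.

(** * Identities in C*-algebras and cosine-sine pairs *)

Section CStarTheory.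
Variables (R : realType) (B : cstarAlgType R).
Implicit Types b c d h k x y z : B.
Local Notation "x ** y" := (cmul x y) (at level 40, left associativity).
Local Notation "x ^#" := (cstar x) (at level 2, format "x ^#").

Lemma cmul0l y : 0 ** y = 0.
Proof. by have := cmulZl (0 : R[i]) 0 y; rewrite !scale0r. Qed.

Lemma cmul0r x : x ** 0 = 0.
Proof. by have := cmulZr (0 : R[i]) x 0; rewrite !scale0r. Qed.

Lemma cmulNl x y : - x ** y = - (x ** y).
Proof. by rewrite -scaleN1r cmulZl scaleN1r. Qed.

Lemma cmulNr x y : x ** - y = - (x ** y).
Proof. by rewrite -scaleN1r cmulZr scaleN1r. Qed.

Lemma cmulBl x y z : (x - y) ** z = x ** z - y ** z.
Proof. by rewrite cmulDl cmulNl. Qed.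

Lemma cmulBr x y z : z ** (x - y) = z ** x - z ** y.
Proof. by rewrite cmulDr cmulNr. Qed.

Lemma cstar0 : (0 : B)^# = 0.
Proof. by have := cstarZ (0 : R[i]) (0 : B); rewrite conjC0 !scale0r. Qed.

Lemma cstarN x : (- x)^# = - x^#.
Proof. by rewrite -scaleN1r cstarZ rmorphN1 scaleN1r. Qed.

Lemma cstarB x y : (x - y)^# = x^# - y^#.
Proof. by rewrite cstarD cstarN. Qed.

Lemma cstarZr (r : R) x : (r%:C *: x)^# = r%:C *: x^#.
Proof. by rewrite cstarZ conj_Creal// ; apply/complex_realP; exists r. Qed.

Lemma cstar_sa x : (x^# ** x)^# = x^# ** x.
Proof. by rewrite cstarM cstarK. Qed.

Lemma ler_rnormM x y : rnorm (x ** y) <= rnorm x * rnorm y.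
Proof. by rewrite -lecR rmorphM/= !rnormE cmul_le_norm. Qed.

Lemma rnorm_starM x : rnorm (x^# ** x) = rnorm x ^+ 2.
Proof. by apply: (@complexI R); rewrite rmorphXn/= !rnormE cstar_norm. Qed.

Lemma rnorm_sa h : h^# = h -> rnorm (h ** h) = rnorm h ^+ 2.
Proof. by move=> sa; rewrite -rnorm_starM sa. Qed.

(** The C*-identity and submultiplicativity bound [rnorm y ^+ 2] by [rnorm y^# * rnorm y]; cancel
    [rnorm y], then apply this to [x] and to [x^#]. *)
Lemma rnorm_star x : rnorm x^# = rnorm x.
Proof.
have le y : rnorm y <= rnorm y^#.
  have := rnorm_ge0 y; rewrite le_eqVlt => /orP[/eqP<-|y0].
    exact: rnorm_ge0.
  by rewrite -(ler_pM2r y0) -expr2 -rnorm_starM ler_rnormM.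
by apply/eqP; rewrite eq_le le andbT -{2}(cstarK x) le.
Qed.

Let i1 : 'i * 'i = -1 :> R[i].
Proof. by rewrite -expr2 sqrCi. Qed.

(* The C*-identity applied to d + i c and d - i c, whose half-sum is d. *)
Lemma rnorm_two_squares b c d : d^# ** c = c^# ** d ->
  d^# ** d + c^# ** c = b^# ** b -> rnorm d <= rnorm b.
Proof.
move=> dc ddcc.
(* With [t] equal to i or -i, the cross terms of the square cancel by [dc]. *)
have rot (t : R[i]) : t * t = -1 -> t^* = - t ->
    rnorm (d + t *: c) = rnorm b.
  move=> tt ct.
  have : rnorm (d + t *: c) ^+ 2 = rnorm b ^+ 2.
    rewrite -!rnorm_starM; congr rnorm.
    rewrite cstarD cstarZ ct cmulDl !cmulDr !cmulZl !cmulZr scalerA mulNr tt.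
    by rewrite opprK scale1r dc scaleNr addrA addrK.
  by move/eqP; rewrite eqrXn2 ?rnorm_ge0// => /eqP.
have iE : ('i : R[i])^* = - 'i by rewrite conjCi.
have dE : d *+ 2 = (d + 'i *: c) + (d + (- 'i) *: c).
  by rewrite scaleNr addrACA subrr addr0 mulr2n.
have : rnorm (d *+ 2) <= rnorm b *+ 2.
  rewrite dE mulr2n; apply: le_trans (ler_rnormD _ _) _.
  rewrite (rot 'i)// (rot (- 'i)) ?mulrNN// rmorphN/=; congr (- _); exact: iE.
by rewrite rnormMn lerMn2r.
Qed.

(* [k, 1 - z] behave like the cosine and the sine of an angle. *)
Definition cossin k z := [/\ k^# = k, z^# = z, k ** z = z ** k
  & k ** k + z ** z = z + z].

Let cossin_comm k z b : cossin k z ->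
  (k ** b)^# ** (b - z ** b) = (b - z ** b)^# ** (k ** b).
Proof.
move=> [sk sz kz kkzz]; rewrite cstarB !cstarM sk sz cmulBl cmulBr !cmulA.
by rewrite -(cmulA _ k z) kz !cmulA.
Qed.

(** This is the Pythagorean identity between [b^#] and [b]: substituting 2z - z^2 for k^2 cancels
    everything but [b^# ** b]. *)
Let cossin_sqr k z b : cossin k z ->
  (k ** b)^# ** (k ** b) + (b - z ** b)^# ** (b - z ** b) = b^# ** b.
Proof.
move=> [sk sz kz kkzz].
rewrite cstarB !cstarM sk sz cmulBl !cmulBr !cmulA -!(cmulA b^#).
rewrite -(addrK (z ** z) (k ** k)) kkzz cmulBl cmulDl cmulBr cmulDr.
rewrite [LHS]addrC addrA opprB addrAC !addrA.
rewrite (ACl (1*(6*2)*(3*5)*(7*4)))/= !subrr.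
by rewrite !addr0.
Qed.

Lemma cossin_mulc k z b : cossin k z -> rnorm (k ** b) <= rnorm b.
Proof.
by move=> kz; exact: rnorm_two_squares (cossin_comm b kz) (cossin_sqr b kz).
Qed.

Lemma cossin_muls k z b : cossin k z -> rnorm (b - z ** b) <= rnorm b.
Proof.
move=> kz; apply: (rnorm_two_squares (esym (cossin_comm b kz))).
by rewrite addrC cossin_sqr.
Qed.

(** Contractivity of the cosine on [k] itself gives |k|^2 = |k k| <= |k|. *)
Lemma cossin_norm k z : cossin k z -> rnorm k <= 1.
Proof.
move=> kz; have [sk _ _ _] := kz.
have := rnorm_ge0 k; rewrite le_eqVlt => /orP[/eqP<-//|k0].
by rewrite -(ler_pM2r k0) mul1r -expr2 -rnorm_sa// (cossin_mulc _ kz).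
Qed.

Lemma cauchy_seq_lim (y : nat -> B) (u : R ^nat) :
  u @ \oo --> 0 -> (forall n m : nat, rnorm (y (n + m)%N - y n) <= u n) ->
  exists l, forall e, 0 < e -> exists n, forall m, (n <= m)%N ->
    rnorm (l - y m) < e.
Proof.
move=> u0 yu.
have : cvg (y @ \oo).
  apply: cauchy_cvg; apply: cauchy_exP => e e0.
  have eE : (complex.Re e)%:C = e by rewrite RRe_real// gtr0_real.
  have Re0 : 0 < complex.Re e by rewrite -ltcR eE.
  have /cvgrPdist_lt/(_ _ Re0)[N _ uN] := u0.
  exists (y N); exists N => // n /= Nn.
  rewrite -ball_normE/= -rnormE -eE ltcR rnormB -(subnKC Nn).
  apply: le_lt_trans (yu _ _) _.
  by apply: le_lt_trans (uN N (leqnn N)); rewrite sub0r normrN ler_norm.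
move/cvg_ex => [l /cvgrPdist_lt yl]; exists l => e e0.
have e0' : 0 < e%:C by rewrite -[0]/(0%:C) ltcR.
have [N _ lN] := yl _ e0'; exists N => m Nm.
by have /= := lN m Nm; rewrite -rnormE ltcR.
Qed.

Let halfD x : (2^-1 : R)%:C *: (x + x) = x.
Proof.
rewrite scalerDr -scalerDl -rmorphD/= -[2^-1]mul1r -splitr.
by rewrite scale1r.
Qed.

(* [z] is the fixed point of z |-> (h^2 + z^2) / 2, i.e. 1 - z is the square root
   of 1 - h^2; the map is a contraction of the ball of radius 1/2. *)
Lemma cossin_exists h : h^# = h -> rnorm h ^+ 2 <= 3 / 4 ->
  exists z, cossin h z.
Proof.
move=> sh hh; pose f x := (2^-1 : R)%:C *: (h ** h + x ** x).
have half0 : 0 <= 2^-1 :> R by [].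
pose y n := iter n f 0.
have fy n : y n.+1 + y n.+1 = h ** h + y n ** y n.
  by rewrite /= -/(y n) /f -scalerDr halfD.
(* The ball of radius 1/2 is preserved because (3/4 + 1/4) / 2 = 1/2; this is where the bound 3/4
   comes from. *)
have yb n : rnorm (y n) <= 2^-1.
  elim: n => [|n ih]; first by rewrite rnorm0.
  rewrite /= -/(y n) rnormZr//.
  have := le_trans (ler_rnormD (h ** h) (y n ** y n))
    (lerD (ler_rnormM _ _) (ler_rnormM _ _)).
  have := rnorm_ge0 (y n).
  by move: hh ih; nra.
have ys n : (y n)^# = y n.
  elim: n => [|n ih]; first by rewrite cstar0.
  by rewrite /= -/(y n) /f cstarZr cstarD !cstarM sh ih.
have yh n : h ** y n = y n ** h.
  elim: n => [|n ih]; first by rewrite cmul0l cmul0r.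
  rewrite /= -/(y n) /f cmulZl cmulZr cmulDl cmulDr cmulA.
  by congr (_ *: (_ + _)); rewrite cmulA ih -cmulA ih cmulA.
have sqB x x' : x ** x - x' ** x' = x ** (x - x') + (x - x') ** x'.
  by rewrite cmulBr cmulBl addrA subrK.
have sqB_le x x' : rnorm (x ** x - x' ** x') <=
    (rnorm x + rnorm x') * rnorm (x - x').
  rewrite sqB; apply: le_trans (ler_rnormD _ _) _.
  by rewrite mulrDl [rnorm x' * _]mulrC; apply: lerD; exact: ler_rnormM.
(* In [sqB_le] the sum of the two norms is at most 1, so the factor 1/2 in [f] is the contraction
   constant. *)
have yc n (k : nat) : rnorm (y (n + k)%N - y n) <= 2^-1 ^+ n.
  elim: n => [|n ih].
    rewrite add0n subr0 expr0; apply: le_trans (yb _) _; lra.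
  rewrite addSn /= -/(y n) -/(y (n + k)%N) /f -scalerBr rnormZr//.
  rewrite opprD addrACA subrr add0r exprS ler_wpM2l//.
  apply: le_trans (sqB_le _ _) (le_trans _ ih).
  have := yb n; have := yb (n + k)%N; have := rnorm_ge0 (y (n + k)%N - y n).
  by set a := rnorm (y n); set b := rnorm _; set c := rnorm _; nra.
have [|l yl] := cauchy_seq_lim _ yc.
  apply: cvg_expr; rewrite ger0_norm//; lra.
exists l; split=> //.
- apply/eqP; rewrite -subr_eq0; apply/eqP.
  apply: (@rnorm_small_eq0 _ _ 2) => // e /yl[n /(_ n (leqnn n)) ln].
  have -> : l^# - l = (l - y n)^# - (l - y n).
    by rewrite cstarB ys opprB addrA subrK.
  apply: le_trans (ler_rnormB _ _) _; rewrite rnorm_star; lra.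
- apply/eqP; rewrite -subr_eq0; apply/eqP.
  apply: (@rnorm_small_eq0 _ _ (2 * rnorm h)).
    by rewrite mulr_ge0// rnorm_ge0.
  move=> e /yl[n /(_ n (leqnn n)) ln].
  have -> : h ** l - l ** h = h ** (l - y n) - (l - y n) ** h.
    by rewrite cmulBr cmulBl yh opprB addrA subrK.
  apply: le_trans (ler_rnormB _ _) _.
  apply: le_trans (lerD (ler_rnormM _ _) (ler_rnormM _ _)) _.
  have := rnorm_ge0 h; nra.
- apply/eqP; rewrite -subr_eq0; apply/eqP.
  apply: (@rnorm_small_eq0 _ _ (rnorm l + 5)).
    by rewrite addr_ge0// rnorm_ge0.
  move=> e /[dup] e0 /yl[n lm]; have l1 := lm n (leqnn n).
  have l2 := lm n.+1 (leqnSn n).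
  (* The recursion [fy] replaces h^2 by 2 y_(n+1) - y_n^2, so that only differences with [l]
     remain. *)
  have -> : h ** h + l ** l - (l + l) =
    (l ** l - y n ** y n) - ((l - y n.+1) + (l - y n.+1)).
    by rewrite [X in _ = _ - X]addrACA -opprD fy opprB [RHS]addrA;
    congr (_ - _); rewrite [X in _ = _ + X]addrC [RHS]addrA subrK addrC.
  apply: le_trans (ler_rnormB _ _) _.
  apply: le_trans (lerD (sqB_le _ _) (ler_rnormD _ _)) _.
  have := yb n; have := rnorm_ge0 l; have := rnorm_ge0 (y n); nra.
Qed.

(** The square of the sine, (1 - z)^2 = 1 - k^2, acting on [b]; there is no unit to state it without
    [b]. *)
Lemma cossin_subK k z b : cossin k z ->
  (b - z ** b) - z ** (b - z ** b) = b - k ** k ** b.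
Proof.
move=> [_ _ _ kkzz]; rewrite -(addrK (z ** z) (k ** k)) kkzz cmulBl cmulDl.
by rewrite cmulBr cmulA -addrA -opprD -addrA.
Qed.

Lemma cossin_subsqr k z b : cossin k z -> rnorm (b - k ** k ** b) <= rnorm b.
Proof.
move=> kz; rewrite -(cossin_subK b kz).
exact: le_trans (cossin_muls _ kz) (cossin_muls _ kz).
Qed.

(* 2 cos sin and 2 cos^2 are the sine and one minus the cosine of twice the
   angle. *)
Lemma cossin_double k z : cossin k z ->
  cossin ((k - z ** k) *+ 2) ((k ** k) *+ 2).
Proof.
move=> kz; have [sk sz ckz _] := kz; set m := k - z ** k.
have mm : m ** m = k ** k - k ** k ** (k ** k).
  rewrite -(cossin_subK (k ** k) kz) {1}/m cmulBl -cmulA.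
  by have -> : k ** m = k ** k - z ** (k ** k) by rewrite cmulBr !cmulA ckz.
have sm : m^# = m by rewrite cstarB cstarM sk sz ckz.
have skk : (k ** k)^# = k ** k by rewrite cstarM sk.
have ckm : m ** (k ** k) = k ** k ** m.
  rewrite cmulBl cmulBr !cmulA; congr (_ - _).
  by rewrite -[k ** k ** z]cmulA ckz cmulA ckz.
clearbody m; split.
- by rewrite mulr2n cstarD sm.
- by rewrite mulr2n cstarD skk.
- by rewrite !mulr2n !cmulDl !cmulDr ckm.
- rewrite !mulr2n !cmulDl !cmulDr mm.
  by rewrite addrACA (addrACA (_ - _)) !subrK.
Qed.

(** The element is (1 - h^2)(1 - z)(h - z h) for the sine 1 - z of [h]. The first two factors
    contract, and twice h - z h is the cosine of the doubled angle, of norm at most 1. *)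
Lemma rnorm_sub_cube h : h^# = h -> rnorm h ^+ 2 <= 3 / 4 ->
  rnorm ((h - h ** h ** h) - h ** h ** (h - h ** h ** h)) <= 2^-1.
Proof.
move=> sh /(cossin_exists sh)[z hz].
apply: le_trans (cossin_subsqr _ hz) _.
rewrite -(cossin_subK _ hz); apply: le_trans (cossin_muls _ hz) _.
have := cossin_norm (cossin_double hz); rewrite rnormMn; lra.
Qed.

Lemma rnorm_sub_cube_scaled h : h^# = h -> exists t : R,
  let k := t%:C *: h in
  rnorm (h - k ** k ** h - k ** k ** (h - k ** k ** h)) <= 5 / 8 * rnorm h.
Proof.
move=> sh; have := rnorm_ge0 h; rewrite le_eqVlt => /orP[/eqP h0|h0].
  exists 0; rewrite /= scale0r !cmul0l !subr0; move: h0; lra.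
(* Norm 4/5 is small enough for [rnorm_sub_cube], as 16/25 <= 3/4, yet exceeds 1/2, which makes the
   ratio (1/2) / (4/5) = 5/8 less than 1. *)
pose t := 4 / 5 / rnorm h; have t0 : 0 < t by rewrite divr_gt0.
exists t => /=; set k := _ *: h.
have nk : rnorm k = 4 / 5 by rewrite (rnormZr _ (ltW t0)) mulfVK ?gt_eqF.
have sk : k^# = k by rewrite cstarZr sh.
have := @rnorm_sub_cube k sk; rewrite nk => /(_ ltac:(lra)).
have -> : k - k ** k ** k = t%:C *: (h - k ** k ** h).
  by rewrite {4}/k cmulZr scalerBr.
rewrite (cmulZr _ (k ** k) (h - _)) -scalerBr (rnormZr _ (ltW t0)).
rewrite -ler_pdivlMl// => /le_trans; apply.
by rewrite /t le_eqVlt; apply/orP; left; apply/eqP; field; rewrite gt_eqF.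
Qed.

(** * Self-adjointness of closed ideals *)

Section Ideal.
Variable I : cstarIdeal B.

(** Take z' = z (1 - k^2) with k a multiple of h = z^# z. Since h commutes with k^2, z'^# z' = (1 -
    k^2)^2 h, whose norm [rnorm_sub_cube_scaled] bounds; the C*-identity turns norms into
    squares. *)
Let step (x z : B) : z - x^# \in I -> z^# ** z \in I ->
  exists z', [/\ z' - x^# \in I, z'^# ** z' \in I &
    rnorm z' ^+ 2 <= 5 / 8 * rnorm z ^+ 2].
Proof.
move=> zx zz; set h := z^# ** z.
have sh : h^# = h := cstar_sa z.
have [t /=] := rnorm_sub_cube_scaled sh; set k := _ *: h => le.
have kI : k ** k \in I by rewrite ideal_mulr// rpredZ.
have sk : (k ** k)^# = k ** k by rewrite cstarM cstarZr sh.
exists (z - z ** (k ** k)).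
have E : (z - z ** (k ** k))^# ** (z - z ** (k ** k)) =
    h - k ** k ** h - k ** k ** (h - k ** k ** h).
  have hk : h ** (k ** k) = k ** k ** h.
    by rewrite /k !(cmulZl, cmulZr) !cmulA.
  rewrite cstarB cstarM sk cmulBl -(cmulA (k ** k)).
  by have -> : z^# ** (z - z ** (k ** k)) = h - k ** k ** h
    by rewrite cmulBr cmulA -/h hk.
split.
- by rewrite addrAC; apply: rpredB => //; exact: ideal_mull.
- have hI : h - k ** k ** h \in I by apply: rpredB => //; exact: ideal_mull.
  by rewrite E; apply: rpredB => //; exact: ideal_mull.
- by rewrite -!rnorm_starM E.
Qed.

(* If z = x^# (1 - e) with e in I, then h = z^# z is in I, and so is
   z - z (t h)^2; for a suitable t this shrinks z by a constant factor. *)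
Lemma ideal_star x : x \in I -> x^# \in I.
Proof.
move=> xI; have zn (n : nat) : exists z, [/\ z - x^# \in I, z^# ** z \in I &
    rnorm z ^+ 2 <= (5 / 8) ^+ n * rnorm x ^+ 2].
  elim: n => [|n [z [zx zz le]]].
    (* For z = x^# the product z^# z is x x^#, which lies in [I] with [x]. *)
    exists x^#; rewrite subrr rpred0 cstarK ideal_mulr//.
    by rewrite expr0 mul1r rnorm_star.
  have [z' [z'x z'z' le']] := step zx zz; exists z'; split=> //.
  by rewrite (exprS (5 / 8)) -mulrA; apply: le_trans le' _; rewrite ler_pM2l.
apply: (@ideal_closed R B I) => U /nbhs_ballP[e /= e0 beU].
have eE : (complex.Re e)%:C = e by rewrite RRe_real// gtr0_real.
have Re0 : 0 < complex.Re e by rewrite -ltcR eE.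
have cvg0 : (fun n => (5 / 8) ^+ n * rnorm x ^+ 2) @ \oo --> (0 : R).
  rewrite -[X in _ --> X](mul0r (rnorm x ^+ 2)).
  by apply: cvgMl; apply: cvg_expr; rewrite ger0_norm//; lra.
have /cvgrPdist_lt/(_ _ (exprn_gt0 2 Re0))[N _ /(_ N (leqnn N))/=] := cvg0.
rewrite sub0r normrN ger0_norm ?mulr_ge0 ?exprn_ge0 ?rnorm_ge0// => le.
have [z [zx _ zN]] := zn N.
(* This element of [I] is at distance |z| from x^#, so x^# is in the closure of [I]. *)
exists (x^# - z) => /=; split; first by rewrite -opprB rpredN.
apply: beU; rewrite -ball_normE/= opprB addrC subrK -rnormE -eE ltcR.
by rewrite -(@ltr_pXn2r _ 2)// ?nnegrE ?rnorm_ge0 ?ltW// (le_lt_trans zN).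
Qed.

End Ideal.

End CStarTheory.

(** * Uniform boundedness of *-homomorphisms *)

Lemma star_hom_bounded (R : realType) (A B : cstarAlgType R) (f : A -> B) :
  star_hom f -> forall a, rnorm (f a) <= 2 * rnorm a.
Proof.
move=> [fD fZ fM fS] a.
have f0 : f 0 = 0 by have := fZ 0 0; rewrite !scale0r.
have := rnorm_ge0 a; rewrite le_eqVlt => /orP[/eqP a0|a0].
  by rewrite (rnorm_eq0 (esym a0)) f0 !rnorm0 mulr0.
(* Scaling to norm 1/2 makes b^# b small enough to be a cosine; it also produces the final constant
   2. *)
pose t := 2^-1 / rnorm a; have t0 : 0 < t by rewrite divr_gt0.
pose b := t%:C *: a.
have nb : rnorm b = 2^-1 by rewrite (rnormZr _ (ltW t0)) mulfVK ?gt_eqF.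
have [|z [sh sz hz hhzz]] := cossin_exists (cstar_sa b).
  by rewrite rnorm_starM nb; lra.
(* The relation [cossin] is purely algebraic, hence preserved by [f], while it forces norm at most
   1. *)
have /cossin_norm : cossin (f (cmul (cstar b) b)) (f z).
  by split; rewrite -?fS -?fM ?sh ?sz ?hz// -!fD hhzz.
rewrite fM fS rnorm_starM expr_le1 ?rnorm_ge0//.
rewrite fZ (rnormZr _ (ltW t0)) /t mulrAC ler_pdivrMr// mul1r.
lra.
Qed.

(** * The C*-algebra of bounded families, and the families in an ideal *)

Section Linf.
Variables (R : realType) (X : Type) (B : cstarAlgType R).

Definition linf_pred : {pred X -> B} :=
  fun f => `[< exists M, forall x, rnorm (f x) <= M >].

Fact linf_pred_submod : submod_closed linf_pred.
Proof.
split=> [|a f g]; first by apply/asboolP; exists 0 => x; rewrite rnorm0.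
move=> /asboolP[M fM] /asboolP[N gN]; apply/asboolP.
exists (complex.Re `|a| * M + N) => x.
apply: le_trans (ler_rnormD _ _) _; apply: lerD (gN x).
by rewrite rnormZ ler_wpM2l// -ler0c RRe_real ?normr_real.
Qed.

HB.instance Definition _ :=
  GRing.isSubmodClosed.Build R[i] (X -> B) linf_pred linf_pred_submod.

Record linf := Linf { linf_fun :> X -> B; linf_funP : linf_fun \in linf_pred }.

HB.instance Definition _ := [isSub for linf_fun].
HB.instance Definition _ := [Choice of linf by <:].
HB.instance Definition _ := [SubChoice_isSubLmodule of linf by <:].

Implicit Types f g : linf.

Lemma linf_ext f g : f =1 g -> f = g.
Proof. by move=> fg; apply/val_inj/funext. Qed.

Lemma linfP f : exists M, forall x, rnorm (f x) <= M.
Proof. by case: f => f /= /asboolP. Qed.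

Lemma linf_mem (f : X -> B) M : (forall x, rnorm (f x) <= M) ->
  f \in linf_pred.
Proof. by move=> fM; apply/asboolP; exists M. Qed.

(** For empty [X] this is the supremum of the empty set, 0, as it should be; the case is treated
    separately below. *)
Definition linf_rnorm f : R := sup (range (fun x => rnorm (f x))).

Lemma linf_rnorm_ub f x : rnorm (f x) <= linf_rnorm f.
Proof.
apply: ub_le_sup; last by exists x.
by have [M fM] := linfP f; exists M => _ [y _ <-].
Qed.

Lemma linf_rnorm_lub f M : 0 <= M -> (forall x, rnorm (f x) <= M) ->
  linf_rnorm f <= M.
Proof.
move=> M0 fM; rewrite /linf_rnorm.
have [->|ne] := eqVneq (range (fun x => rnorm (f x))) set0.
  by rewrite sup0.
by apply: ge_sup => [|_ [x _ <-]//]; exact/set0P.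
Qed.

Lemma linf_rnorm_ge0 f : 0 <= linf_rnorm f.
Proof.
rewrite /linf_rnorm.
have [->|/set0P[_ [x _ _]]] := eqVneq (range (fun x => rnorm (f x))) set0.
  by rewrite sup0.
exact: le_trans (rnorm_ge0 (f x)) (linf_rnorm_ub f x).
Qed.

Definition linf_norm f : R[i] := (linf_rnorm f)%:C.

Fact linf_ler_normD f g : linf_norm (f + g) <= linf_norm f + linf_norm g.
Proof.
rewrite /linf_norm -rmorphD/= lecR.
apply: linf_rnorm_lub => [|x]; first by rewrite addr_ge0// linf_rnorm_ge0.
by apply: le_trans (ler_rnormD _ _) _; rewrite lerD// linf_rnorm_ub.
Qed.

Let Re_norm_ge0 (a : R[i]) : 0 <= complex.Re `|a|.
Proof. by rewrite -ler0c RRe_real ?normr_real. Qed.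

Let linf_rnormZ_le a f : linf_rnorm (a *: f) <= complex.Re `|a| * linf_rnorm f.
Proof.
apply: linf_rnorm_lub => [|x]; first by rewrite mulr_ge0// linf_rnorm_ge0.
by rewrite rnormZ ler_wpM2l// linf_rnorm_ub.
Qed.

Fact linf_normZ a f : linf_norm (a *: f) = `|a| * linf_norm f.
Proof.
have rE (c : R[i]) : (complex.Re `|c|)%:C = `|c| by rewrite RRe_real ?normr_real.
rewrite -(rE a) /linf_norm -(rmorphM (real_complex R)); congr (_%:C).
apply/eqP; rewrite eq_le linf_rnormZ_le.
have [->|a0] := eqVneq a 0.
  have -> : complex.Re `|0 : R[i]| = 0 by apply: complexI; rewrite rE normr0.
  by rewrite mul0r linf_rnorm_ge0.
have a_gt0 : 0 < complex.Re `|a| by rewrite -ltcR rE normr_gt0.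
(* The reverse inequality is the first one for the inverse scalar. *)
have := linf_rnormZ_le a^-1 (a *: f); rewrite scalerA mulVf// scale1r.
have -> : complex.Re `|a^-1| = (complex.Re `|a|)^-1.
  by apply: (@complexI R); rewrite rE fmorphV/= rE normfV.
by rewrite ler_pdivlMl.
Qed.

Fact linf_norm0_eq0 f : linf_norm f = 0 -> f = 0.
Proof.
move=> /complexI f0; apply: linf_ext => x; apply/rnorm_eq0/eqP.
by rewrite eq_le rnorm_ge0 -f0 linf_rnorm_ub.
Qed.

HB.instance Definition _ := Lmodule_isNormed.Build R[i] linf
  linf_ler_normD linf_normZ linf_norm0_eq0.

Lemma rnorm_linf_le f (M : R) : 0 <= M ->
  (forall x, rnorm (f x) <= M) -> rnorm f <= M.
Proof. exact: linf_rnorm_lub. Qed.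

Lemma rnorm_linf_ge f x : rnorm (f x) <= rnorm f.
Proof. exact: linf_rnorm_ub. Qed.

Fact linf_mul_subproof f g : (fun x => cmul (f x) (g x)) \in linf_pred.
Proof.
apply: (@linf_mem _ (rnorm f * rnorm g)) => x.
apply: le_trans (ler_rnormM _ _) _.
by rewrite ler_pM ?rnorm_ge0 ?rnorm_linf_ge.
Qed.

Fact linf_star_subproof f : (fun x => cstar (f x)) \in linf_pred.
Proof.
by apply: (@linf_mem _ (rnorm f)) => x; rewrite rnorm_star rnorm_linf_ge.
Qed.

HB.instance Definition _ := hasMulStar.Build R linf
  (fun f g => Linf (linf_mul_subproof f g))
  (fun f => Linf (linf_star_subproof f)).

(** The limit is taken pointwise; the Cauchy condition then makes it bounded and the convergence
    uniform. *)
Fact linf_complete (F : set_system linf) : ProperFilter F -> cauchy F -> cvg F.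
Proof.
move=> FF /cauchyP Fc.
have near_ball (e : R) : 0 < e ->
    exists f, F [set g : linf | rnorm (f - g) < e].
  move=> e0; have [|f Ff] := Fc e%:C; first by rewrite -[0]/(0%:C) ltcR.
  exists f; apply: filterS Ff => g; rewrite -ball_normE/=.
  by rewrite -rnormE ltcR.
have Re_gt0 (e : R[i]) : 0 < e ->
    0 < complex.Re e /\ (complex.Re e)%:C = e.
  move=> e0; have eE : (complex.Re e)%:C = e by rewrite RRe_real// gtr0_real.
  by rewrite -ltcR eE.
have evc x : cvg ((fun g : linf => g x) @ F).
  apply: cauchy_cvg; apply: cauchy_exP => e /Re_gt0[e0 eE].
  have [f Ff] := near_ball _ e0; exists (f x).
  suff : F [set g : linf | ball (f x) e (g x)] by [].
  apply: filterS Ff => g /= fg; rewrite -ball_normE/= -rnormE -eE ltcR.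
  exact: le_lt_trans (rnorm_linf_ge (f - g) x) fg.
pose l x : B := lim ((fun g : linf => g x) @ F).
(* The intermediate [g] depends on [x], but the resulting bound does not. *)
have l_near f e : 0 < e -> F [set g : linf | rnorm (f - g) < e] ->
    forall x, rnorm (l x - f x) <= e *+ 2.
  move=> e0 Ff x; have /cvgrPdist_lt lx := evc x.
  have e0' : 0 < e%:C by rewrite -[0]/(0%:C) ltcR.
  have [g [/= lg fg]] := filter_ex (filterI (lx _ e0') Ff).
  rewrite -(subrK (g x) (l x)) -addrA; apply: le_trans (ler_rnormD _ _) _.
  rewrite mulr2n lerD//; first by rewrite ltW// -ltcR rnormE.
  rewrite rnormB; apply: le_trans (ltW fg); exact: (rnorm_linf_ge (f - g)).
have lb : l \in linf_pred.
  have [f /(l_near _ _ ltr01) lf] := near_ball _ ltr01.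
  apply: (@linf_mem _ (1 *+ 2 + rnorm f)) => x.
  rewrite -(subrK (f x) (l x)); apply: le_trans (ler_rnormD _ _) _.
  by rewrite lerD// rnorm_linf_ge.
apply/cvg_ex; exists (Linf lb); apply/cvgrPdist_le => e /Re_gt0[e0 eE].
(* One third bounds f - g and two thirds bound l - f. *)
have e30 : 0 < complex.Re e / 3 by rewrite divr_gt0.
have [f Ff] := near_ball _ e30.
apply: filterS (Ff) => g /= fg; rewrite -rnormE -eE lecR.
apply: rnorm_linf_le => [|x]; first exact: ltW.
have -> : (Linf lb - g) x = (l x - f x) + (f - g) x by rewrite /= addrA subrK.
apply: le_trans (ler_rnormD _ _) _.
have := l_near _ _ e30 Ff x; have := rnorm_linf_ge (f - g) x.
rewrite mulr2n; move: fg; lra.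
Qed.

HB.instance Definition _ := Uniform_isComplete.Build linf linf_complete.

Fact linf_cmulA : associative (@cmul R linf).
Proof. by move=> f g h; apply: linf_ext => x; exact: cmulA. Qed.

Fact linf_cmulDl : left_distributive (@cmul R linf) +%R.
Proof. by move=> f g h; apply: linf_ext => x; exact: cmulDl. Qed.

Fact linf_cmulDr : right_distributive (@cmul R linf) +%R.
Proof. by move=> f g h; apply: linf_ext => x; exact: cmulDr. Qed.

Fact linf_cmulZl (a : R[i]) f g : cmul (a *: f) g = a *: cmul f g.
Proof. by apply: linf_ext => x; exact: cmulZl. Qed.

Fact linf_cmulZr (a : R[i]) f g : cmul f (a *: g) = a *: cmul f g.
Proof. by apply: linf_ext => x; exact: cmulZr. Qed.

Fact linf_cmul_le_norm f g : `|cmul f g| <= `|f| * `|g|.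
Proof.
rewrite -!rnormE -rmorphM/= lecR.
apply: rnorm_linf_le => [|x]; first by rewrite mulr_ge0// rnorm_ge0.
apply: le_trans (ler_rnormM _ _) _.
by rewrite ler_pM ?rnorm_ge0 ?rnorm_linf_ge.
Qed.

Fact linf_cstarK : involutive (@cstar R linf).
Proof. by move=> f; apply: linf_ext => x; exact: cstarK. Qed.

Fact linf_cstarD : {morph @cstar R linf : f g / f + g}.
Proof. by move=> f g; apply: linf_ext => x; exact: cstarD. Qed.

Fact linf_cstarZ (a : R[i]) f : cstar (a *: f) = a^* *: cstar f.
Proof. by apply: linf_ext => x; exact: cstarZ. Qed.

Fact linf_cstarM f g : cstar (cmul f g) = cmul (cstar g) (cstar f).
Proof. by apply: linf_ext => x; exact: cstarM. Qed.

Fact linf_cstar_norm f : `|cmul (cstar f) f| = `|f| ^+ 2.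
Proof.
rewrite -!rnormE -rmorphXn/=; congr (_%:C); apply/eqP; rewrite eq_le.
apply/andP; split.
  apply: rnorm_linf_le => [|x]; first by rewrite exprn_ge0// rnorm_ge0.
  by rewrite rnorm_starM lerXn2r ?nnegrE ?rnorm_ge0 ?rnorm_linf_ge.
(* Taking square roots reduces the claim to a bound on each coordinate of [f]. *)
rewrite -[leRHS]sqr_sqrtr ?rnorm_ge0// lerXn2r ?nnegrE ?rnorm_ge0 ?sqrtr_ge0//.
apply: rnorm_linf_le => [|x]; first exact: sqrtr_ge0.
rewrite -[leLHS]ger0_norm ?rnorm_ge0// -sqrtr_sqr ler_wsqrtr//.
by rewrite -rnorm_starM; exact: (rnorm_linf_ge (cmul (cstar f) f)).
Qed.

HB.instance Definition _ := isCStarAlgebra.Build R linf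
  linf_cmulA linf_cmulDl linf_cmulDr linf_cmulZl linf_cmulZr
  linf_cmul_le_norm linf_cstarK linf_cstarD linf_cstarZ linf_cstarM
  linf_cstar_norm.

Variable I : cstarIdeal B.

Definition linf_ideal_pred : {pred linf} := fun f => `[< forall x, f x \in I >].

Fact linf_ideal_submod : submod_closed linf_ideal_pred.
Proof.
split=> [|a f g /asboolP fI /asboolP gI]; apply/asboolP => x.
  exact: rpred0.
by apply: rpredD => //; exact: rpredZ.
Qed.

Fact linf_ideal_mulr f g : f \in linf_ideal_pred -> cmul f g \in linf_ideal_pred.
Proof. by move=> /asboolP fI; apply/asboolP => x; exact: ideal_mulr. Qed.

Fact linf_ideal_mull f g : g \in linf_ideal_pred -> cmul f g \in linf_ideal_pred.
Proof. by move=> /asboolP gI; apply/asboolP => x; exact: ideal_mull. Qed.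

Fact linf_ideal_closed : closed [set f | f \in linf_ideal_pred].
Proof.
move=> f fI; apply/asboolP => x.
apply: (@ideal_closed R B I) => U /nbhs_ballP[e /= e0 beU].
have [g [/asboolP gI fg]] := fI _ (nbhsx_ballx f e e0).
exists (g x); split; first exact: gI.
apply: beU; move: fg; rewrite -!ball_normE/=; apply: le_lt_trans.
by rewrite -!rnormE lecR; exact: (rnorm_linf_ge (f - g)).
Qed.

Definition linf_ideal : cstarIdeal linf :=
  CStarIdeal linf_ideal_submod linf_ideal_mulr linf_ideal_mull
    linf_ideal_closed.

End Linf.

(** * Quotient norms and the quotient map as a *-homomorphism *)

Section QuotientNorm.
Variables (R : realType) (B : cstarAlgType R) (I : cstarIdeal B).
Implicit Types b : B.

Lemma rnorm_cquot_pi b : rnorm (cquot_pi I b) <= rnorm b.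
Proof.
by apply: ge_inf; [exists 0 => _ [c _ <-]; exact: rnorm_ge0 | exists b].
Qed.

Lemma cquot_lift (x : cquot I) (e : R) : rnorm x < e ->
  exists2 b, cquot_pi I b = x & rnorm b < e.
Proof.
have ne : [set rnorm b | b in [set b : B | cquot_pi I b = x]] !=set0.
  by exists (rnorm (cquot_repr x)), (cquot_repr x) => //; exact: cquot_reprK.
by move=> /(inf_lt ne)[_ [b bx <-] be]; exists b.
Qed.

(** The involution of the quotient uses a chosen representative; self-adjointness of [I] makes the
    choice immaterial. *)
Lemma cquot_pi_star b : cquot_pi I (cstar b) = cstar (cquot_pi I b).
Proof.
apply/cquot_piE; rewrite -cstarB; apply: ideal_star.
by apply/cquot_piE; rewrite cquot_reprK.
Qed.

Lemma cquot_piB b c : cquot_pi I (b - c) = cquot_pi I b - cquot_pi I c.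
Proof. by rewrite cquot_piD -scaleN1r cquot_piZ scaleN1r. Qed.

Lemma star_hom_cquot_pi (A : cstarAlgType R) (f : A -> B) :
  star_hom f -> star_hom (@cquot_pi R B I \o f).
Proof.
move=> [fD fZ fM fS]; split=> [x y|a x|x y|x] /=.
- by rewrite fD cquot_piD.
- by rewrite fZ cquot_piZ.
- by rewrite fM cquot_piM.
- by rewrite fS cquot_pi_star.
Qed.

End QuotientNorm.

(** * The point-norm topology on spaces of *-homomorphisms *)

Section HomSpace.
Variables (R : realType) (A : cstarAlgType R).

Lemma hom_star_hom (D : mulStarType R) (f : Hom A D) : star_hom (\val f).
Proof. exact: set_valP f. Qed.

Definition hom_of (D : mulStarType R) (f : A -> D) (fh : star_hom f) : Hom A D :=
  exist _ (f : {ptws A -> D}) (mem_set fh).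

Lemma hom_cvgP (D : mulStarType R) (F : set_system (Hom A D)) (f : Hom A D) :
  Filter F -> (forall a, (fun g : Hom A D => \val g a) @ F --> \val f a) ->
  F --> f.
Proof.
move=> FF Ff U [_ [[W oW <-] Wf WU]]; apply: filterS WU _.
have : {ptws, (fun g : Hom A D => \val g) @ F --> \val f}.
  exact/pointwise_cvgP.
by apply; exact: open_nbhs_nbhs.
Qed.

Lemma hom_eval_continuous (D : mulStarType R) (a : A) :
  continuous (fun g : Hom A D => \val g a).
Proof.
move=> f; have : {ptws, (fun g : Hom A D => \val g) @ f --> \val f}.
  exact: initial_continuous.
by move/pointwise_cvgP => fcvg; apply: fcvg; exact: (fmap_filter _ (nbhs_filter f)).
Qed.

End HomSpace.

(** * Splicing a limit homomorphism into the family of all homomorphisms *)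

Section Closed.
Variables (R : realType) (A B : cstarAlgType R) (I : cstarIdeal B).
Implicit Types (V : set (Hom A (cquot I))) (psi : Hom A B).

Definition hom_cquot_pi psi : Hom A (cquot I) :=
  hom_of (star_hom_cquot_pi I (hom_star_hom psi)).

Local Notation E := (linf (Hom A B) B).
Local Notation K := (linf_ideal (Hom A B) I).

(** The bound 2|a| does not depend on [psi], so the family of all values at [a] is bounded. *)
Fact all_homs_subproof a : (fun psi => \val psi a) \in @linf_pred R (Hom A B) B.
Proof.
apply: (@linf_mem _ _ _ _ (2 * rnorm a)) => psi.
exact: star_hom_bounded (hom_star_hom psi) a.
Qed.

Definition all_homs a : E := Linf (all_homs_subproof a).

Lemma all_homs_star_hom : star_hom all_homs.
Proof.
split=> [a b|t a|a b|a]; apply: linf_ext => psi; have [] := hom_star_hom psi.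
- by move=> + _ _ _; exact.
- by move=> _ + _ _; exact.
- by move=> _ _ + _; exact.
- by move=> _ _ _; exact.
Qed.

Variable phi : Hom A (cquot I).

Fact splice_subproof V a : (fun psi => if `[< V (hom_cquot_pi psi) >]
  then cquot_repr (\val phi a) else \val psi a) \in @linf_pred R (Hom A B) B.
Proof.
apply: (@linf_mem _ _ _ _ (rnorm (cquot_repr (\val phi a)) + 2 * rnorm a)).
move=> psi; have := star_hom_bounded (hom_star_hom psi) a.
have := rnorm_ge0 (cquot_repr (\val phi a)); have := rnorm_ge0 a.
by case: ifP => _; lra.
Qed.

(** The representatives of phi(a) are chosen without regard to the operations, so it is only modulo
    [K] that a homomorphism results. *)
Definition splice V a : cquot K := cquot_pi K (Linf (splice_subproof V a)).

Lemma cquot_pi_linf (f g : E) :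
  (forall psi, cquot_pi I (f psi) = cquot_pi I (g psi)) <->
  cquot_pi K f = cquot_pi K g.
Proof.
split=> [fg|/cquot_piE/asboolP fg psi]; apply/cquot_piE; last exact: fg.
by apply/asboolP => psi; apply/cquot_piE; exact: fg.
Qed.

Lemma cquot_pi_splice V psi a :
  cquot_pi I (Linf (splice_subproof V a) psi) =
  if `[< V (hom_cquot_pi psi) >] then \val phi a
  else \val (hom_cquot_pi psi) a.
Proof. by rewrite /=; case: ifP => _; rewrite ?cquot_reprK. Qed.

(** Equality modulo [K] is tested coordinatewise modulo [I], where the splice is either [phi] or the
    composite of [psi] with the quotient map. *)
Lemma splice_star_hom V : star_hom (splice V).
Proof.
have [pD pZ pM pS] := hom_star_hom phi.
split=> [a b|t a|a b|a]; rewrite /splice.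
- rewrite -cquot_piD; apply/cquot_pi_linf => psi.
  rewrite (cquot_piD I (Linf _ psi)) !cquot_pi_splice.
  have [qD _ _ _] := hom_star_hom (hom_cquot_pi psi).
  by case: ifP => _; [exact: pD | exact: qD].
- rewrite -cquot_piZ; apply/cquot_pi_linf => psi.
  rewrite (cquot_piZ I t (Linf _ psi)) !cquot_pi_splice.
  have [_ qZ _ _] := hom_star_hom (hom_cquot_pi psi).
  by case: ifP => _; [exact: pZ | exact: qZ].
- rewrite -cquot_piM; apply/cquot_pi_linf => psi.
  rewrite (cquot_piM I (Linf _ psi)) !cquot_pi_splice.
  have [_ _ qM _] := hom_star_hom (hom_cquot_pi psi).
  by case: ifP => _; [exact: pM | exact: qM].
- rewrite -cquot_pi_star; apply/cquot_pi_linf => psi.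
  rewrite (cquot_pi_star I (Linf _ psi)) !cquot_pi_splice.
  have [_ _ _ qS] := hom_star_hom (hom_cquot_pi psi).
  by case: ifP => _; [exact: pS | exact: qS].
Qed.

Definition hom_splice V : Hom A (cquot K) := hom_of (splice_star_hom V).

Definition hom_all : Hom A (cquot K) :=
  hom_of (star_hom_cquot_pi K all_homs_star_hom).

Lemma rnorm_splice_le V a (e : R) : 0 < e ->
  V `<=` [set chi | rnorm (\val chi a - \val phi a) < e] ->
  rnorm (cquot_pi K (all_homs a) - splice V a) <= e.
Proof.
move=> e0 Ve; rewrite -cquot_piB.
set d := all_homs a - _.
(* In each coordinate the difference has a representative of norm at most [e]: 0 outside [V], a
   nearly optimal lift inside. Together they form a bounded family representing [d] modulo [K]. *)
have /choice[w wP] psi : exists b, cquot_pi I b = cquot_pi I (d psi) /\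
    rnorm b <= e.
  have dE : cquot_pi I (d psi) = \val (hom_cquot_pi psi) a -
      (if `[< V (hom_cquot_pi psi) >] then \val phi a
       else \val (hom_cquot_pi psi) a).
    by rewrite -cquot_pi_splice; exact: cquot_piB.
  rewrite dE; case: ifP => [/asboolP/Ve/cquot_lift[b bx be]|_].
    by exists b; split=> //; exact: ltW.
  by exists 0; rewrite rnorm0 subrr cquot_pi0 ltW.
have wl : w \in @linf_pred R (Hom A B) B.
  by apply: (@linf_mem _ _ _ _ e) => psi; have [] := wP psi.
have -> : cquot_pi K d = cquot_pi K (Linf wl).
  by apply/cquot_pi_linf => psi; have [-> _] := wP psi.
apply: le_trans (rnorm_cquot_pi _ _) _.
by apply: rnorm_linf_le => [|psi]; [exact: ltW | have [] := wP psi].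
Qed.

(** The filter is that of ever smaller neighbourhoods [V] of [phi]. For fixed [a], such a [V]
    eventually lies in the set where evaluation at [a] is [e]-close to that of [phi]. *)
Lemma hom_splice_cvg :
  hom_splice @ powerset_filter_from (nbhs phi) --> hom_all.
Proof.
apply: hom_cvgP => a; apply/cvgrPdist_le => /= e e0.
have eE : (complex.Re e)%:C = e by rewrite RRe_real// gtr0_real.
have Re0 : 0 < complex.Re e by rewrite -ltcR eE.
have /cvgrPdist_lt/(_ _ e0) near_phi := @hom_eval_continuous _ A (cquot I) a phi.
suff : \forall V \near powerset_filter_from (nbhs phi),
  `|\val hom_all a - \val (hom_splice V) a| <= e by [].
have := small_set_sub near_phi.
apply: filterS => V Ve; rewrite -rnormE -eE lecR.
apply: rnorm_splice_le => // chi /Ve /=.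
by rewrite -rnormE -eE ltcR rnormB.
Qed.

Lemma liftable_closure : open (liftable A E K) ->
  closure (liftable A B I) phi -> liftable A B I phi.
Proof.
move=> openL clphi.
have Lall : liftable A E K hom_all by exists (hom_of all_homs_star_hom).
have near_lift : \forall V \near powerset_filter_from (nbhs phi),
    liftable A E K (hom_splice V).
  exact: hom_splice_cvg (open_nbhs_nbhs (conj openL Lall)).
(* One [V] is both small enough for its splice to lift, to [T], and still a neighbourhood of [phi],
   hence meets the liftable set. *)
have [V [[T TE] Vphi]] :=
  filter_ex (filterI near_lift (near_small_set (nbhs_pfilter phi))).
have [chi [[psi psiE] Vchi]] := clphi V Vphi.
have chiE : chi = hom_cquot_pi psi by exact: val_inj.
have [tD tZ tM tS] := hom_star_hom T.
have evh : star_hom (fun a => \val T a psi).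
  by split=> [a b|t a|a b|a]; rewrite ?(tD, tZ, tM, tS).
exists (hom_of evh); apply/funext => a /=.
have /esym/cquot_pi_linf/(_ psi) : splice V a = cquot_pi K (\val T a).
  by have := congr1 (fun f => f a) TE.
(* The composite of [psi] with the quotient map is [chi], which lies in [V], so coordinate [psi] of
   the splice is [phi]. *)
rewrite cquot_pi_splice; case: ifP => [_ /esym//|/asboolP].
by rewrite -chiE.
Qed.

End Closed.

Theorem corollary3p10 (R : realType) (A : cstarAlgType R) :
  ell_open A -> ell_closed A.
Proof.
by move=> openA B I phi; apply: liftable_closure; exact: openA.
Qed.
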